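(* Let $K(x,y) := \max(1+xy, 0)$ for $(x,y) \in \mathbb{R}\times\mathbb{R}$ (the Jain--Karlin--Schoenberg kernel). Fix an integer $p \geq 2$ and a scalar $\alpha \geq 0$. \begin{enumerate} \item If $\alpha \geq p-2$, then $K^\alpha$ is $\mathrm{TN}_p$ on $\mathbb{R}\times\mathbb{R}$. \item If $K^\alpha$ is $\mathrm{TN}_p$ on $\mathbb{R}\times\mathbb{R}$, then $\alpha \in \mathbb{Z}^{\geq 0}\cup[p-2,\infty)$. More strongly, for all $\mathbf{x},\mathbf{y} \in \operatorname{inc}(\mathbb{R},p)$ with $1 + x_j y_k > 0$ for all $j,k$, the matrix $((1+x_jy_k)^\alpha)_{j,k=1}^p$ is (a) $\mathrm{TP}$ if $\alpha > p-2$; (b) $\mathrm{TN}$ if $\alpha \in \{0,1,\dots,p-2\}$; (c) not $\mathrm{TN}$ if $\alpha \in (0,p-2)\setminus\mathbb{Z}$. \item Let $I \subset \mathbb{R}$ be an interval of positive length with $I \subset [0,\infty)$ or $I \subset (-\infty,0]$. Then $K^\alpha$ restricted to $I \times \mathbb{R}$ (equivalently, to $\mathbb{R} \times I$) is $\mathrm{TN}_p$ if and only if $\alpha \in \mathbb{Z}^{\geq 0}\cup[p-2,\infty)$. In particular, for $\alpha\in\mathbb{Z}^{\ge0}$ these restrictions of $K^\alpha$ are $\mathrm{TN}$. \end{enumerate}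
   Context: For a totally ordered set $X$ and integer $r \geq 1$, $\operatorname{inc}(X,r)$ denotes the set of $r$-tuples $(x_1,\dots,x_r) \in X^r$ with $x_1 < \cdots < x_r$. For $X,Y \subset \mathbb{R}$, a kernel $K : X \times Y \to \mathbb{R}$ is $\mathrm{TN}_p$ if $\det (K(x_j,y_k))_{j,k=1}^r \geq 0$ for all $1 \leq r \leq p$ and all $\mathbf{x} \in \operatorname{inc}(X,r)$, $\mathbf{y} \in \operatorname{inc}(Y,r)$; $\mathrm{TN}$ if $\mathrm{TN}_p$ for all $p$. A real matrix is $\mathrm{TN}$/$\mathrm{TP}$ if all its minors are $\ge0$/$>0$. $K^\alpha$ means $(x,y)\mapsto K(x,y)^\alpha$. Convention: $0^0 := 0$. *)

(* Defs.v *)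
From HB Require Import structures.
From mathcomp Require Import all_boot all_order all_algebra.
From mathcomp Require Import all_classical all_reals all_analysis.
Set Implicit Arguments. Unset Strict Implicit. Unset Printing Implicit Defensive.
Import Order.TTheory GRing.Theory Num.Theory.
Local Open Scope ring_scope.
Local Open Scope classical_set_scope.

(* real power with the convention 0^0 := 0 (t^a := 0 for t <= 0) *)
Definition rpow0 {R : realType} (t a : R) : R := if 0 < t then powR t a else 0.

Definition JKS {R : realType} (x y : R) : R := Num.max (1 + x * y) 0.

Definition JKSpow {R : realType} (a : R) (x y : R) : R := rpow0 (JKS x y) a.

Definition inc {R : realType} (X : set R) (r : nat) (x : 'I_r -> R) : Prop :=
  (forall i, X (x i)) /\ (forall i j : 'I_r, (i < j)%N -> x i < x j).

Definition TNp {R : realType} (X Y : set R) (K : R -> R -> R) (p : nat) : Prop :=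
  forall (r : nat), (1 <= r <= p)%N -> forall (x y : 'I_r -> R),
    inc X x -> inc Y y -> 0 <= \det (\matrix_(j < r, k < r) K (x j) (y k)).

Definition TNker {R : realType} (X Y : set R) (K : R -> R -> R) : Prop :=
  forall p, TNp X Y K p.

Definition incidx (r m : nat) (f : 'I_r -> 'I_m) : Prop :=
  forall i j : 'I_r, (i < j)%N -> (f i < f j)%N.

Definition minor {R : realType} m n r (A : 'M[R]_(m, n)) (f : 'I_r -> 'I_m) (g : 'I_r -> 'I_n) : R :=
  \det (\matrix_(i < r, j < r) A (f i) (g j)).

Definition TNmx {R : realType} m n (A : 'M[R]_(m, n)) : Prop :=
  forall r (f : 'I_r -> 'I_m) (g : 'I_r -> 'I_n), (1 <= r)%N ->
    incidx f -> incidx g -> 0 <= minor A f g.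
Definition TPmx {R : realType} m n (A : 'M[R]_(m, n)) : Prop :=
  forall r (f : 'I_r -> 'I_m) (g : 'I_r -> 'I_n), (1 <= r)%N ->
    incidx f -> incidx g -> 0 < minor A f g.

Definition is_natR {R : realType} (a : R) : Prop := exists n : nat, a = n%:R.

(* Main.v *)
(* With x = tan t and y = tan f one has 1 + x y = cos (t - f) / (cos t cos f), so up to positive row
   and column factors the determinants are those of the kernel cos (t - f)_+ ^ a, which is invariant
   under rotations.  Divide the rows by |cos (t - phi_0)| ^ a, where phi_0 is the first column node, and
   subtract neighbouring rows: the rows with t - phi_0 < pi/2 are subtracted from their successor and the
   others from their predecessor, the last one using a zero row at t = phi_N + pi/2.  By the mean value
   theorem, applied to one row at a time, the determinant of size N + 1 and exponent a then has the sign
   of a ^ N times determinants of size N and exponent a - 1.  If all entries are positive this gives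
   sgn det = prod_(i < N) sgn (a - i) ^ (N - i); in general it gives det >= 0 for a >= N - 1.
   For a natural and nodes x > 0, the kernel is a positive multiple of the truncated power
   (y + 1 / x)_+ ^ a, which is totally nonnegative by the same differencing, from a = 0 upwards. *)

Require Import Defs.
From HB Require Import structures.
From mathcomp Require Import all_boot all_order all_algebra.
From mathcomp Require Import perm.
From mathcomp Require Import ring lra zify.
From mathcomp Require Import all_classical all_reals all_analysis.
Set Implicit Arguments. Unset Strict Implicit. Unset Printing Implicit Defensive.
Import Order.TTheory GRing.Theory Num.Theory.
Import numFieldNormedType.Exports.
Local Open Scope ring_scope.
Local Open Scope classical_set_scope.

(** * Real powers with [0 ^ 0 = 0]: algebra, continuity, derivative *)

Lemma rpow0_ge0 (R : realType) (t a : R) : 0 <= rpow0 t a.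
Proof. by rewrite /rpow0; case: ifP => // _; exact: powR_ge0. Qed.

Lemma rpow0_gt0 (R : realType) (t a : R) : 0 < t -> 0 < rpow0 t a.
Proof. by move=> t0; rewrite /rpow0 t0 powR_gt0. Qed.

Lemma rpow0_eq0 (R : realType) (t a : R) : t <= 0 -> rpow0 t a = 0.
Proof. by rewrite /rpow0 leNgt => /negbTE ->. Qed.

Lemma rpow0M (R : realType) (c t a : R) : 0 < c ->
  rpow0 (c * t) a = rpow0 c a * rpow0 t a.
Proof.
move=> c0; rewrite /rpow0 c0 pmulr_rgt0 //; case: ifP => t0; last by rewrite mulr0.
by rewrite powRM // ltW.
Qed.

Lemma rpow0V (R : realType) (t a : R) : 0 < t -> rpow0 t^-1 a = (rpow0 t a)^-1.
Proof.
move=> t0; rewrite /rpow0 invr_gt0 t0 -[in LHS](powR_inv1 (ltW t0)) -powRrM.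
by rewrite mulN1r powRN.
Qed.

Lemma rpow0S (R : realType) (t a : R) : 0 < t -> rpow0 t a = t * rpow0 t (a - 1).
Proof.
move=> t0; rewrite /rpow0 t0 -{2}(powRr1 (ltW t0)) -powRD; last by rewrite (gt_eqF t0) implybT.
by congr powR; ring.
Qed.

(** For [a <= 0] the function is discontinuous at [t = 0]; this is why later arguments ask for
    [0 < a] or for positive cosines. *)
Lemma rpow0_continuous (R : realType) (t a : R) : 0 < a \/ 0 < t ->
  {for t, continuous (fun x : R => rpow0 x a)}.
Proof.
move=> H; have [t0|t0|t0] := ltgtP t 0.
- apply: (@cvg_trans _ ((fun=> 0 : R) @ t)); last first.
    by rewrite rpow0_eq0 ?ltW //; exact: (@cst_continuous R R 0).
  apply: near_eq_cvg; near=> x; rewrite rpow0_eq0 // ltW //.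
  by near: x; exact: lt_nbhsl.
- apply: (@cvg_trans _ ((fun x : R => powR x a) @ t)).
    apply: near_eq_cvg; near=> x; rewrite /rpow0 ifT //.
    by near: x; exact: lt_nbhsr.
  rewrite /rpow0 t0; suff : {for t, continuous (fun x : R => powR x a)} by [].
  apply: differentiable_continuous; apply/derivable1_diffP.
  exact: (@ex_derive _ _ _ _ _ _ _ (is_derive1_powR a t0)).
- have a0 : 0 < a by case: H; rewrite ?t0 ?ltxx.
  apply/cvgrPdist_lt => e e0; near=> x; rewrite /= [rpow0 t a]rpow0_eq0 ?t0 //.
  rewrite sub0r normrN ger0_norm ?rpow0_ge0 // /rpow0; case: ifP => x0 //.
  have : x < powR e a^-1 by near: x; apply: lt_nbhsl; rewrite t0 powR_gt0.
  move=> xe; rewrite -[ltRHS](powRr1 (ltW e0)) -[1](mulVf (lt0r_neq0 a0)) powRrM.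
  by rewrite gt0_ltr_powR ?nnegrE ?powR_ge0 // ltW.
Unshelve. all: by end_near. Qed.

(** For [t < 0] the function is locally zero and the right-hand side vanishes by the convention, so
    the origin is the only exceptional point. *)
Lemma is_derive_rpow0 (R : realType) (t a : R) : t != 0 ->
  is_derive t 1 (fun x : R => rpow0 x a) (a * rpow0 t (a - 1)).
Proof.
rewrite neq_lt => /orP[t0|t0].
- rewrite rpow0_eq0 ?ltW // mulr0.
  apply: (@near_eq_is_derive _ _ _ (cst 0 : R -> R)).
  near=> x; rewrite rpow0_eq0 // ltW //.
  by near: x; exact: lt_nbhsl.
- have H := is_derive1_powR a t0.
  rewrite {2}/rpow0 t0; apply: near_eq_is_derive H.
  near=> x; rewrite /rpow0 ifT //.
  by near: x; exact: lt_nbhsr.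
Unshelve. all: by end_near. Qed.

(** * Mean value arguments with values in a convex cone *)

(** Only strictly positive scalars occur, so [Q v] may be [0 < v], [v < 0] or [v = 0] as well as
    [0 <= v]. *)
Definition convex_cone {R : realType} (Q : R -> Prop) : Prop :=
  (forall u v, Q u -> Q v -> Q (u + v)) /\ (forall c u, 0 < c -> Q u -> Q (c * u)).

(** By the mean value theorem the increment is a positive multiple of a value of [g]. Exceptional
    points are removed by induction on [S]: cutting the interval at such a point makes the increment
    a sum of two. *)
Lemma increment_in_cone (R : realType) (Q : R -> Prop) (S : seq R) (G g : R -> R) (a b : R) :
  convex_cone Q -> a < b ->
  (forall t, a <= t <= b -> {for t, continuous G}) ->
  (forall t, a < t < b -> t \notin S -> is_derive t 1 G (g t)) ->
  (forall t, a < t < b -> t \notin S -> Q (g t)) ->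
  Q (G b - G a).
Proof.
move=> [QD QM]; elim: S a b => [|p S IH] a b ab cG dG Qg.
  have [c cab ->] : exists2 c, c \in `]a, b[%R & G b - G a = g c * (b - a).
    apply: MVT => // [x|].
      by rewrite in_itv /= => /dG; apply.
    apply: continuous_in_subspaceT => x; rewrite inE /= in_itv /=; exact: cG.
  rewrite mulrC; apply: QM; first by rewrite subr_gt0.
  by apply: Qg => //; move: cab; rewrite in_itv.
have [/andP[ap pb]|pN] := boolP (a < p < b).
  rewrite -(subrKA (G p)); apply: QD; apply: IH => // t /andP[at_ tb].
  - by apply: cG; rewrite (le_trans (ltW ap)).
  - move=> tS; apply: dG; first by rewrite (lt_trans ap).
    by rewrite inE negb_or tS gt_eqF.
  - move=> tS; apply: Qg; first by rewrite (lt_trans ap).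
    by rewrite inE negb_or tS gt_eqF.
  - by apply: cG; rewrite at_ (le_trans tb) // ltW.
  - move=> tS; apply: dG; first by rewrite at_ (lt_trans tb).
    by rewrite inE negb_or tS lt_eqF.
  - move=> tS; apply: Qg; first by rewrite at_ (lt_trans tb).
    by rewrite inE negb_or tS lt_eqF.
by apply: IH => // t tab tS; [apply: dG|apply: Qg] => //; rewrite inE negb_or tS andbT;
  apply: contraNneq pN => <-.
Qed.

(* A determinant is linear in each row, so the rows can be replaced by elements of [S] one at a time. *)
Lemma det_rows_in_cone (R : realType) n (Q : R -> Prop) (S : 'I_n -> ('I_n -> R) -> Prop)
    (d : 'I_n -> 'I_n -> R) :
  (forall i (c : 'I_n -> R), (forall s, S i s -> Q (\sum_k c k * s k)) ->
     Q (\sum_k c k * d i k)) ->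
  (forall s, (forall i, S i (s i)) -> Q (\det (\matrix_(i, k) s i k))) ->
  Q (\det (\matrix_(i, k) d i k)).
Proof.
move=> Hd HS.
suff H m : (m <= n)%N -> forall s : 'I_n -> 'I_n -> R, (forall i : 'I_n, (m <= i)%N -> S i (s i)) ->
    Q (\det (\matrix_(i < n, k < n) if (i < m)%N then d i k else s i k)).
  have := H n (leqnn n) d; set A := \matrix_(i, k) _.
  have -> : A = \matrix_(i, k) d i k by apply/matrixP => i k; rewrite !mxE ltn_ord.
  by apply => i; rewrite leqNgt ltn_ord.
elim: m => [_ s Ss|m IH mn s Ss].
  have -> : \matrix_(i < n, k < n) (if (i < 0)%N then d i k else s i k) = \matrix_(i, k) s i k.
    by apply/matrixP => i k; rewrite !mxE.
  by apply: HS => i; exact: Ss.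
pose i0 := Ordinal mn.
pose B v := \matrix_(i < n, k < n) (if (i < m)%N then d i k else if i == i0 then v k else s i k).
have detB v : \det (B v) = \sum_k cofactor (B (fun=> 0)) i0 k * v k.
  rewrite (expand_det_row _ i0); apply: eq_bigr => k _.
  rewrite mulrC mxE ltnn eqxx; congr (_ * _); rewrite /cofactor; congr (_ * \det _).
  by apply/matrixP => i j; rewrite !mxE eq_sym (negbTE (neq_lift _ _)).
have -> : \matrix_(i, k) (if (i < m.+1)%N then d i k else s i k) = B (d i0).
  apply/matrixP => i k; rewrite !mxE ltnS leq_eqVlt -(inj_eq val_inj) /=.
  case: ltngtP => // im; congr (d _ k); exact: val_inj.
rewrite detB; apply: Hd => v Sv; rewrite -detB.
have := IH (ltnW mn) (fun i => if i == i0 then v else s i).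
set A := \matrix_(i, k) _.
have -> : A = B v by apply/matrixP => i k; rewrite !mxE; case: ifP => //; case: eqP.
apply => i mi; case: eqVneq => [-> //|/eqP ii0]; apply: Ss.
rewrite ltn_neqAle mi andbT; apply/eqP => e; apply: ii0; exact: val_inj.
Qed.

(** * Determinants under row operations, scaling and reversal *)

(** The operation is multiplication by the unitriangular matrix [1 + C]. *)
Lemma det_row_op_lower (R : comPzRingType) n (C A : 'M[R]_n) :
  (forall i j : 'I_n, (i <= j)%N -> C i j = 0) -> \det (A + C *m A) = \det A.
Proof.
move=> C0; rewrite -{1}[A]mul1mx -mulmxDl det_mulmx det_trig.
  by rewrite big1 ?mul1r // => i _; rewrite !mxE eqxx C0 // addr0.
by apply/is_trig_mxP => i j ij; rewrite !mxE -(inj_eq val_inj) ltn_eqF // C0 ?addr0 // ltnW.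
Qed.

Lemma det_row_op_upper (R : comPzRingType) n (C A : 'M[R]_n) :
  (forall i j : 'I_n, (j <= i)%N -> C i j = 0) -> \det (A + C *m A) = \det A.
Proof.
move=> C0; rewrite -{1}[A]mul1mx -mulmxDl det_mulmx -det_tr det_trig.
  by rewrite big1 ?mul1r // => i _; rewrite !mxE eqxx C0 // addr0.
apply/is_trig_mxP => i j ij; rewrite !mxE -(inj_eq val_inj) gtn_eqF // C0 ?addr0 //.
exact: ltnW.
Qed.

Lemma det_scale_rows_cols (R : comPzRingType) n (a b : 'I_n -> R) (A : 'M[R]_n) :
  \det (\matrix_(i, k) (a i * A i k * b k)) = (\prod_i a i) * (\prod_k b k) * \det A.
Proof.
have -> : \matrix_(i, k) (a i * A i k * b k) =
    diag_mx (\row_i a i) *m A *m diag_mx (\row_k b k).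
  by apply/matrixP => i k; rewrite mul_mx_diag mul_diag_mx !mxE.
rewrite !det_mulmx !det_diag mulrAC; congr (_ * _ * _); apply: eq_bigr => i _; by rewrite mxE.
Qed.

Lemma det_col_delta (R : comPzRingType) n (A : 'M[R]_n.+1) :
  (forall i : 'I_n, A (lift ord0 i) ord0 = 0) ->
  \det A = A ord0 ord0 * \det (\matrix_(i < n, k < n) A (lift ord0 i) (lift ord0 k)).
Proof.
move=> A0; rewrite (expand_det_col _ ord0) big_ord_recl big1 ?addr0; last first.
  by move=> i _; rewrite A0 mul0r.
by rewrite /cofactor expr0 mul1r; congr (_ * \det _); apply/matrixP => i k; rewrite !mxE.
Qed.

Lemma det_row0 (R : comPzRingType) n (A : 'M[R]_n) i : (forall k, A i k = 0) -> \det A = 0.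
Proof. by move=> Ai0; rewrite (expand_det_row _ i) big1 // => k _; rewrite Ai0 mul0r. Qed.

Lemma det_col0 (R : comPzRingType) n (A : 'M[R]_n) k : (forall i, A i k = 0) -> \det A = 0.
Proof. by move=> Ak0; rewrite (expand_det_col _ k) big1 // => i _; rewrite Ak0 mul0r. Qed.

(** The sign of the reversal enters twice, once for the rows and once for the columns. *)
Lemma det_rev (R : comPzRingType) n (A : 'M[R]_n) :
  \det (\matrix_(i, k) A (rev_ord i) (rev_ord k)) = \det A.
Proof.
pose s := perm (@rev_ord_inj n).
have -> : \matrix_(i, k) A (rev_ord i) (rev_ord k) = row_perm s (col_perm s A).
  by apply/matrixP => i k; rewrite !mxE !permE.
rewrite row_permE col_permE !det_mulmx !det_perm odd_permV.
by rewrite mulrCA -signr_addb addbb mulr1.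
Qed.

(** * Signs of the cosine, and increments of the kernel [cosk] *)

Lemma cos_lt0_pihalf (R : realType) (x : R) : pi / 2 < `|x| < 3 * (pi / 2) -> cos x < 0.
Proof.
move=> /andP[x1 x2]; rewrite -cos_norm -[`|x|](subrK pi) cosDpi oppr_lt0.
by apply: cos_gt0_pihalf; apply/andP; split; lra.
Qed.

Lemma cos_gt0E (R : realType) (x : R) : `|x| < 3 * (pi / 2) -> (0 < cos x) = (`|x| < pi / 2).
Proof.
move=> x2; have [x1|x1|x1] := ltgtP `|x| (pi / 2).
- by apply: cos_gt0_pihalf; rewrite -ltr_norml.
- by apply/negbTE; rewrite -leNgt ltW // cos_lt0_pihalf // x1.
- by rewrite -cos_norm x1 cos_pihalf ltxx.
Qed.

Lemma cos_neq0 (R : realType) (x : R) :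
  `|x| < 3 * (pi / 2) -> x != pi / 2 -> x != - (pi / 2) -> cos x != 0.
Proof.
move=> x2 x3 x4; have [x1|x1|x1] := ltgtP `|x| (pi / 2).
- by rewrite gt_eqF // cos_gt0E.
- by rewrite lt_eqF // cos_lt0_pihalf // x1.
- by move: x3 x4; case: (ger0P x) x1 => _ <-; rewrite ?opprK eqxx.
Qed.

(** The subtraction formula collapses the numerator to [sin (f - p)], which is independent of [t]
    and can later leave the determinant as a column factor. *)
Lemma is_derive_cos_ratio (R : realType) (t f p : R) : cos (t - p) != 0 ->
  is_derive t 1 (fun x => cos (x - f) / cos (x - p)) (sin (f - p) / cos (t - p) ^+ 2).
Proof.
move=> tp.
have D g : is_derive t 1 (fun x => cos (x - g)) (- sin (t - g)).
  rewrite -[X in is_derive _ _ _ X]mulr1.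
  exact: (@is_derive1_comp R cos (shift (- g)) t _ _ (is_derive_cos _) (is_derive_shift t 1 (- g))).
have E : sin (f - p) / cos (t - p) ^+ 2 =
    cos (t - f) *: (- cos (t - p) ^- 2 *: - sin (t - p)) + (cos (t - p))^-1 *: - sin (t - f).
  have -> : f - p = (t - p) - (t - f) by ring.
  by rewrite sinB /GRing.scale /=; field.
rewrite E; exact: (is_deriveM (D f) (@is_deriveV R _ _ _ _ tp (D p))).
Qed.

Definition cosk {R : realType} (a t f : R) : R := rpow0 (cos (t - f)) a.

Lemma coskE (R : realType) (a t f p : R) : 0 < cos (t - p) ->
  cosk a t f / cosk a t p = rpow0 (cos (t - f) / cos (t - p)) a.
Proof.
move=> tp; rewrite /cosk [cos (t - f) / _]mulrC rpow0M ?invr_gt0 // rpow0V //.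
exact: mulrC.
Qed.

Lemma lincomb_continuous (R : realType) n (c : 'I_n -> R) (h : 'I_n -> R -> R) (t : R) :
  (forall k, {for t, continuous (h k)}) -> {for t, continuous (\sum_k (c k \*: h k))}.
Proof.
move=> ch; elim/big_ind: _ => [|f g|k _].
- exact: cst_continuous.
- exact: continuousD.
- by apply: continuousZr; exact: ch.
Qed.

(* Off the finitely many zeros of [cos (t - phi k)], the quotient [cosk a t (phi k) / cosk a t psi] has
   derivative [a * sin (phi k - psi) * cosk (a - 1) t (phi k)] times a positive factor independent of [k]. *)
Lemma cosk_increment (R : realType) n (Q : R -> Prop) (a psi u v : R) (phi c : 'I_n -> R) :
  convex_cone Q -> u < v ->
  (forall t, u <= t <= v -> `|t - psi| < pi / 2) ->
  (forall t k, u <= t <= v -> `|t - phi k| < 3 * (pi / 2)) ->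
  (0 < a \/ forall t k, u <= t <= v -> 0 < cos (t - phi k)) ->
  (forall t C : R, u < t < v -> 0 < C ->
     Q (\sum_k c k * (C * a * sin (phi k - psi) * cosk (a - 1) t (phi k)))) ->
  Q (\sum_k c k * (cosk a v (phi k) / cosk a v psi - cosk a u (phi k) / cosk a u psi)).
Proof.
move=> coneQ uv Hpsi Hphi Ha HQ.
have cpsi t : u <= t <= v -> 0 < cos (t - psi).
  by move=> /Hpsi H; apply: cos_gt0_pihalf; rewrite -ltr_norml.
pose G := \sum_(k < n) (c k \*: (fun t => rpow0 (cos (t - phi k) / cos (t - psi)) a)).
have GE t : G t = \sum_k c k * rpow0 (cos (t - phi k) / cos (t - psi)) a.
  by rewrite /G fct_sumE.
have -> : \sum_k c k * (cosk a v (phi k) / cosk a v psi - cosk a u (phi k) / cosk a u psi) = G v - G u.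
  rewrite !GE -sumrB; apply: eq_bigr => k _.
  by rewrite mulrBr !coskE // cpsi // lexx ltW.
pose g t := \sum_k c k * ((cos (t - psi) ^+ 2 * rpow0 (cos (t - psi)) (a - 1))^-1
                          * a * sin (phi k - psi) * cosk (a - 1) t (phi k)).
(* For [|t - phi k| < 3 * (pi / 2)] the cosine vanishes at these two points only. *)
pose S := flatten [seq [:: phi k + pi / 2; phi k - pi / 2] | k <- enum 'I_n].
apply: (@increment_in_cone _ _ S G g) => // [t tuv|t tuv tS|t tuv _].
- have ct := cpsi _ tuv.
  apply: lincomb_continuous => k.
  apply: (@continuous_comp _ _ _ (fun t => cos (t - phi k) / cos (t - psi)) (fun x => rpow0 x a)).
    apply: differentiable_continuous; apply/derivable1_diffP.
    by apply: ex_derive; apply: is_derive_cos_ratio; rewrite gt_eqF.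
  apply: rpow0_continuous; case: Ha => [|Hc]; [by left|right].
  by rewrite divr_gt0 // Hc.
- have tuv' : u <= t <= v by case/andP: tuv => /ltW -> /ltW ->.
  have ct := cpsi _ tuv'.
  have -> : g t = \sum_(k < n) (c k *: ((a * rpow0 (cos (t - phi k) / cos (t - psi)) (a - 1)) *
      (sin (phi k - psi) / cos (t - psi) ^+ 2))).
    apply: eq_bigr => k _; rewrite /GRing.scale /= -coskE // /cosk.
    have := rpow0_gt0 (a - 1) ct; set w := rpow0 _ _; set z := cos (t - psi) in ct * => w0.
    by field; rewrite !gt_eqF.
  apply: is_derive_sum => k; apply: is_deriveZ.
  apply: (@is_derive1_comp _ (fun x => rpow0 x a) (fun t => cos (t - phi k) / cos (t - psi))).
    apply: is_derive_rpow0; rewrite mulf_neq0 ?invr_eq0 ?(gt_eqF ct) //.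
    apply: cos_neq0; first exact: Hphi.
      apply: contraNneq tS => e; apply/flatten_mapP; exists k; rewrite ?mem_enum // !inE.
      by rewrite -e addrC subrK eqxx.
    apply: contraNneq tS => e; apply/flatten_mapP; exists k; rewrite ?mem_enum // !inE.
    by apply/orP; right; rewrite -e addrC subrK.
  by apply: is_derive_cos_ratio; rewrite gt_eqF.
- have tuv' : u <= t <= v by case/andP: tuv => /ltW -> /ltW ->.
  by apply: HQ => //; rewrite invr_gt0 mulr_gt0 ?exprn_gt0 ?rpow0_gt0 ?cpsi.
Qed.

Lemma cosk_gt0 (R : realType) (a t f : R) : `|t - f| < pi / 2 -> 0 < cosk a t f.
Proof. by move=> tf; apply/rpow0_gt0/cos_gt0_pihalf; rewrite -ltr_norml. Qed.

Lemma cosk_eq0 (R : realType) (a t f : R) :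
  pi / 2 <= `|t - f| < 3 * (pi / 2) -> cosk a t f = 0.
Proof.
move=> /andP[h1 h2]; apply: rpow0_eq0.
by rewrite leNgt cos_gt0E // -leNgt.
Qed.

Lemma increasing_bounds (R : realType) N (f : 'I_N.+1 -> R) :
  (forall i j : 'I_N.+1, (i < j)%N -> f i < f j) -> forall k, f ord0 <= f k <= f ord_max.
Proof.
move=> f_inc k; apply/andP; split.
  have [->|k0] := eqVneq k ord0; first exact: lexx.
  by apply/ltW/f_inc; rewrite lt0n.
have [->|k0] := eqVneq k ord_max; first exact: lexx.
apply/ltW/f_inc; rewrite ltn_neqAle -ltnS ltn_ord andbT.
by apply: contraNneq k0 => e; apply/eqP/val_inj.
Qed.

(** * One reduction step: size [N + 1], exponent [a] to size [N], exponent [a - 1] *)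

Section Reduction.
Variables (R : realType) (N : nat) (Q : R -> Prop) (a : R) (theta phi : 'I_N.+1 -> R).
Hypotheses (coneQ : convex_cone Q)
  (phi_inc : forall i j : 'I_N.+1, (i < j)%N -> phi i < phi j)
  (theta_inc : forall i j : 'I_N.+1, (i < j)%N -> theta i < theta j)
  (phi_pi : phi ord_max - phi ord0 < pi)
  (theta_rng : forall i, phi ord0 - pi / 2 < theta i < phi ord_max + pi / 2)
  (theta0 : theta ord0 < phi ord0 + pi / 2)
  (Ha : 0 < a \/ forall i k, `|theta i - phi k| < pi / 2).

(* The extra value is a point where [cosk _ t (phi k) = 0] for all [k]. *)
Let T (i : nat) : R := if (i <= N)%N then theta (inord i) else phi ord_max + pi / 2.
(** Rows with node below [X] have a positive entry in the first column, rows with node at or beyond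
    [X] a zero. *)
Let X : R := phi ord0 + pi / 2.

Let TE (i : 'I_N.+1) : T i = theta i.
Proof. by rewrite /T -ltnS ltn_ord inord_val. Qed.

Let T_inc i j : (i < j)%N -> (j <= N.+1)%N -> T i < T j.
Proof.
move=> ij jN; rewrite /T; have iN : (i <= N)%N by lia.
rewrite iN; case: ifP => jN'; last by have /andP[] := theta_rng (inord i).
by apply: theta_inc; rewrite !inordK.
Qed.

Let T_rng i : phi ord0 - pi / 2 < T i <= phi ord_max + pi / 2.
Proof.
rewrite /T; case: ifP => _.
  by have /andP[-> /ltW ->] := theta_rng (inord i).
rewrite lexx andbT; have := pi_gt0 R.
have : phi ord0 <= phi ord_max.
  by have /andP[] := increasing_bounds phi_inc ord_max.
by move=> *; lra.
Qed.

Let phi_bnd k : phi ord0 <= phi k <= phi ord_max.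
Proof. exact: increasing_bounds. Qed.

Let rng_dist t k : phi ord0 - pi / 2 < t <= phi ord_max + pi / 2 -> `|t - phi k| < 3 * (pi / 2).
Proof.
move=> /andP[? ?]; have /andP[? ?] := phi_bnd k; have ? := phi_pi.
by rewrite ltr_norml; apply/andP; split; lra.
Qed.

Let sin_phi_gt0 (k : 'I_N) : 0 < sin (phi (lift ord0 k) - phi ord0).
Proof.
have := @phi_inc ord0 (lift ord0 k) isT; have /andP[_ ?] := phi_bnd (lift ord0 k).
by have ? := phi_pi => ?; apply: sin_gt0_pi; apply/andP; split; lra.
Qed.

Let kap (u v p : R) : R := cosk a u p / cosk a v p.

(** Row [i + 1] after differencing. Before [X] the factor [kap] clears the first column. Beyond [X]
    that column is already zero and the weight is taken at [phi ord0 + pi], where the cosine is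
    minus the one at [phi ord0], hence positive. *)
Let D (i : 'I_N) (k : 'I_N.+1) : R :=
  if T i.+1 < X then cosk a (T i.+1) (phi k) - kap (T i.+1) (T i) (phi ord0) * cosk a (T i) (phi k)
  else cosk a (T i.+1) (phi k)
       - kap (T i.+1) (T i.+2) (phi ord0 + pi) * cosk a (T i.+2) (phi k).

Let near_phi0 t : phi ord0 - pi / 2 < t -> t < X -> `|t - phi ord0| < pi / 2.
Proof. by rewrite /X => ? ?; rewrite ltr_norml; apply/andP; split; lra. Qed.

Let far_phi0 t : X <= t -> t <= phi ord_max + pi / 2 -> cosk a t (phi ord0) = 0.
Proof.
rewrite /X => ? ?; apply: cosk_eq0.
by have := phi_pi; have := pi_gt0 R => ? ?; rewrite ger0_norm; [apply/andP; split|]; lra.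
Qed.

Let D_col0 i : D i ord0 = 0.
Proof.
have /andP[Ti1 Ti2] := T_rng i.+1; rewrite /D; case: ltP => [TX|XT].
  have iT : T i < T i.+1 by apply: T_inc => //; have := ltn_ord i; lia.
  have /andP[Ti3 _] := T_rng i.
  by rewrite /kap divfK ?subrr // gt_eqF // cosk_gt0 // near_phi0 // (lt_trans iT).
have iT : T i.+1 < T i.+2 by apply: T_inc => //; have := ltn_ord i; lia.
have /andP[_ Ti3] := T_rng i.+2.
by rewrite !far_phi0 // ?mulr0 ?subrr // (le_trans XT) // ltW.
Qed.

(** [C1] subtracts successors from the rows at or beyond [X], then [C2] subtracts predecessors from
    the rows before [X]. The second operation only uses rows that the first left alone. The first
    column is then zero below its top entry. *)
Let det_reduction : \det (\matrix_(i, k) cosk a (theta i) (phi k)) =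
  cosk a (theta ord0) (phi ord0) * \det (\matrix_(i < N, k < N) D i (lift ord0 k)).
Proof.
pose A := \matrix_(i < N.+1, k < N.+1) cosk a (T i) (phi k).
have -> : \matrix_(i, k) cosk a (theta i) (phi k) = A.
  by apply/matrixP => i k; rewrite !mxE TE.
pose C1 := \matrix_(i < N.+1, j < N.+1)
  (if (X <= T i) && (j == i.+1 :> nat) then - kap (T i) (T i.+1) (phi ord0 + pi) else 0).
pose C2 := \matrix_(i < N.+1, j < N.+1)
  (if (T i < X) && (i == j.+1 :> nat) then - kap (T i) (T j) (phi ord0) else 0).
pose A1 := A + C1 *m A.
rewrite -(@det_row_op_upper _ _ C1); last first.
  move=> i j ji; rewrite mxE; case: eqP => [e|_]; last by rewrite andbF.
  by move: ji; rewrite e ltnn.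
rewrite -/A1 -(@det_row_op_lower _ _ C2); last first.
  move=> i j ji; rewrite mxE; case: eqP => [e|_]; last by rewrite andbF.
  by move: ji; rewrite e ltnn.
have A1E i k : A1 i k = if T i < X then cosk a (T i) (phi k)
    else cosk a (T i) (phi k) - kap (T i) (T i.+1) (phi ord0 + pi) * cosk a (T i.+1) (phi k).
  rewrite !mxE; case: ltP => XT.
    by rewrite big1 ?addr0 // => j _; rewrite !mxE leNgt XT mul0r.
  congr (_ + _); have [iN|iN] := ltnP i.+1 N.+1.
    rewrite (bigD1 (Ordinal iN)) //= big1 ?addr0 => [|j jne].
      by rewrite !mxE XT eqxx mulNr.
    rewrite !mxE XT; case: eqP => [e|]; last by rewrite mul0r.
    by case/eqP: jne; apply: val_inj.
  (* The last row has no successor in the matrix; the extra node stands for a zero row. *)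
  have -> : cosk a (T i.+1) (phi k) = 0.
    rewrite /T ifF; last by apply/negbTE; rewrite -ltnNge.
    have /andP[? ?] := phi_bnd k; have ? := phi_pi; have ? := pi_gt0 R.
    by apply: cosk_eq0; rewrite ger0_norm; [apply/andP; split|]; lra.
  rewrite mulr0 oppr0 big1 // => j _; rewrite !mxE.
  case: eqP => [e|]; last by rewrite andbF mul0r.
  by move: (ltn_ord j); rewrite e ltnNge iN.
have TX0 : T 0 < X by rewrite (TE ord0).
have A2_0 k : (A1 + C2 *m A1) ord0 k = cosk a (theta ord0) (phi k).
  rewrite mxE A1E /= TX0 mxE big1 ?addr0 ?(TE ord0) // => j _.
  by rewrite mxE andbF mul0r.
have A2_S i k : (A1 + C2 *m A1) (lift ord0 i) k = D i k.
  rewrite mxE A1E mxE lift0 /D; case: ifPn => XT; last first.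
    by rewrite big1 ?addr0 // => j _; rewrite mxE lift0 (negbTE XT) mul0r.
  have iT : T i < T i.+1 by apply: T_inc => //; have := ltn_ord i; lia.
  rewrite (bigD1 (widen_ord (leqnSn N) i)) //= big1 ?addr0 => [|j jne].
    by rewrite mxE A1E lift0 XT eqxx /= (lt_trans iT XT) mulNr.
  rewrite mxE lift0 XT eqSS; case: eqP => [e|]; last by rewrite mul0r.
  by case/eqP: jne; apply: val_inj.
rewrite det_col_delta; last by move=> i; rewrite A2_S D_col0.
by rewrite A2_0; congr (_ * \det _); apply/matrixP => i k; rewrite [LHS]mxE [RHS]mxE A2_S.
Qed.

(** Each row of [D] is a weighted increment in the node, so [cosk_increment] lets it be replaced by
    a row of exponent [a - 1] at an intermediate point; the row factors [a] give [a ^+ N], and the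
    sines and constants are positive. The conditional bound on [t] keeps all entries positive in
    later reductions if they are so now. *)
Lemma cosk_det_reduction :
  (forall t : 'I_N -> R, (forall i j : 'I_N, (i < j)%N -> t i < t j) ->
     (forall i, phi ord0 - pi / 2 < t i < phi ord_max + pi / 2) ->
     ((forall i k, `|theta i - phi k| < pi / 2) ->
        forall i, theta ord0 < t i < theta ord_max) ->
     Q (a ^+ N * \det (\matrix_(i, k) cosk (a - 1) (t i) (phi (lift ord0 k))))) ->
  Q (\det (\matrix_(i, k) cosk a (theta i) (phi k))).
Proof.
move=> HQ; rewrite det_reduction; apply: coneQ.2.
  apply: cosk_gt0; apply: near_phi0 => //.
  by have /andP[] := theta_rng ord0.
(* The place of the intermediate point for row [i]. The second interval contains its left end
   because a node equal to [X] is its own intermediate point. *)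
pose I i t := if T i.+1 < X then T i < t < T i.+1 else T i.+1 <= t < T i.+2.
pose S (i : 'I_N) (s : 'I_N -> R) := exists t C : R, [/\ 0 < C, I i t &
  s = fun k => C * a * cosk (a - 1) t (phi (lift ord0 k)) * sin (phi (lift ord0 k) - phi ord0)].
have step (i : 'I_N) : T i < T i.+1 < T i.+2.
  by rewrite !T_inc //; have := ltn_ord i; lia.
apply: (@det_rows_in_cone _ _ _ S (fun i k => D i (lift ord0 k))) => [i c HS|s Ss].
  have HS' t C : 0 < C -> I i t -> Q (\sum_k c k * (C * a * sin (phi (lift ord0 k) - phi ord0)
      * cosk (a - 1) t (phi (lift ord0 k)))).
    move=> C0 It; under eq_bigr => k _ do rewrite mulrAC.
    by apply: (HS (fun k => _)); exists t, C.
  have /andP[T1 T2] := step i.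
  have /andP[r1 _] := T_rng i; have /andP[_ r2] := T_rng i.+2.
  have Hpos u v : T i <= u -> u <= v -> v <= T i.+2 ->
      (forall t k, u <= t <= v -> `|t - phi (lift ord0 k)| < 3 * (pi / 2)).
    move=> iu uv vi t k /andP[ut tv]; apply: rng_dist; apply/andP; split.
      by rewrite (lt_le_trans r1) // (le_trans iu).
    by rewrite (le_trans tv) // (le_trans vi).
  (* Positivity of all entries extends to the points between the nodes, so there the exponent may be
     zero or negative. *)
  have Hnear u v : (forall i k, `|theta i - phi k| < pi / 2) -> T i <= u -> v <= T i.+1 ->
      (forall t (k : 'I_N), u <= t <= v -> 0 < cos (t - phi (lift ord0 k))).
    move=> near iu vi t k /andP[ut tv]; apply: cos_gt0_pihalf.
    have := near ord0 (lift ord0 k); have := near ord_max (lift ord0 k).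
    have : theta ord0 <= T i.
      by rewrite -(TE ord0) /=; have [->//|i0] := posnP i; apply/ltW/T_inc => //; have := ltn_ord i; lia.
    have : T i.+1 <= theta ord_max.
      rewrite -(TE ord_max) /= ; have [->//|iN] := eqVneq (val i).+1 N.
      by apply/ltW/T_inc => //; have := ltn_ord i; move: iN => /eqP /=; lia.
    rewrite !ltr_norml => ? ? /andP[? ?] /andP[? ?]; apply/andP; split; lra.
  case: (ltP (T i.+1) X) => TX.
    have w0 t : T i <= t <= T i.+1 -> 0 < cosk a t (phi ord0).
      move=> /andP[ti tS]; apply: cosk_gt0; apply: near_phi0; first exact: lt_le_trans ti.
      exact: le_lt_trans TX.
    have -> : \sum_k c k * D i (lift ord0 k) = cosk a (T i.+1) (phi ord0) *
        \sum_k c k * (cosk a (T i.+1) (phi (lift ord0 k)) / cosk a (T i.+1) (phi ord0) -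
                      cosk a (T i) (phi (lift ord0 k)) / cosk a (T i) (phi ord0)).
      rewrite mulr_sumr; apply: eq_bigr => k _; rewrite /D TX /kap.
      have := w0 (T i.+1); have := w0 (T i); rewrite !lexx ltW // => /(_ isT) ? /(_ isT) ?.
      by field; rewrite !gt_eqF.
    apply: coneQ.2; first by rewrite w0 // lexx ltW.
    apply: cosk_increment => //.
    - move=> t /andP[ti tS]; apply: near_phi0; first exact: lt_le_trans ti.
      exact: le_lt_trans TX.
    - by apply: Hpos => //; exact: ltW.
    - by case: Ha => [|near]; [left|right; apply: Hnear].
    - by move=> t C tT C0; apply: HS' => //; rewrite /I TX.
  (* A node at or beyond [X] is at distance at least [pi / 2] from [phi ord0], which rules out the
     second alternative of [Ha]. *)
  have a0 : 0 < a.
    case: Ha => // near; exfalso; have := near (lift ord0 i) ord0.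
    by rewrite -TE lift0 ltr_norml => /andP[_]; move: TX; rewrite /X => ? ?; lra.
  have DE k : D i (lift ord0 k) = cosk a (T i.+1) (phi (lift ord0 k))
       - kap (T i.+1) (T i.+2) (phi ord0 + pi) * cosk a (T i.+2) (phi (lift ord0 k)).
    by rewrite /D ltNge TX.
  have : X <= T i.+1 by [].
  rewrite le_eqVlt => /orP[/eqP XT|XT].
    (* At the node [X] the factor [kap] is zero, so nothing is subtracted. As [cos (X - phi k)]
       equals [sin (phi k - phi ord0)], splitting off one power gives the required row with
       [C = a^-1]. *)
    have -> : \sum_k c k * D i (lift ord0 k) = \sum_k c k * (a^-1 * a *
        sin (phi (lift ord0 k) - phi ord0) * cosk (a - 1) (T i.+1) (phi (lift ord0 k))).
      apply: eq_bigr => k _; rewrite DE /kap {2}/cosk -XT /X rpow0_eq0; last first.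
        have -> : phi ord0 + pi / 2 - (phi ord0 + pi) = - (pi / 2) :> R by field.
        by rewrite cosN cos_pihalf.
      rewrite !mul0r subr0 mulVf ?gt_eqF // mul1r /cosk.
      have <- : cos (phi ord0 + pi / 2 - phi (lift ord0 k)) = sin (phi (lift ord0 k) - phi ord0).
        by rewrite -cosBpihalf -cosN; congr cos; ring.
      rewrite rpow0S //.
      have -> : phi ord0 + pi / 2 - phi (lift ord0 k) = - (phi (lift ord0 k) - phi ord0 - pi / 2) by ring.
      by rewrite cosN cosBpihalf.
    by apply: HS'; rewrite ?invr_gt0 // /I -XT ltxx lexx /= XT.
  have w0 t : T i.+1 <= t <= T i.+2 -> `|t - (phi ord0 + pi)| < pi / 2.
    move=> /andP[ti tS]; rewrite ltr_norml; have := phi_pi; move: XT; rewrite /X => ? ?.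
    by apply/andP; split; lra.
  have wu : 0 < cosk a (T i.+1) (phi ord0 + pi) by rewrite cosk_gt0 // w0 // lexx ltW.
  have wv : 0 < cosk a (T i.+2) (phi ord0 + pi) by rewrite cosk_gt0 // w0 // lexx ltW.
  (* The row is a decrement, hence the coefficients [- c k]; the shift of the sine by [pi] restores
     the sign. *)
  have -> : \sum_k c k * D i (lift ord0 k) = cosk a (T i.+1) (phi ord0 + pi) *
        \sum_k (- c k) * (cosk a (T i.+2) (phi (lift ord0 k)) / cosk a (T i.+2) (phi ord0 + pi) -
                      cosk a (T i.+1) (phi (lift ord0 k)) / cosk a (T i.+1) (phi ord0 + pi)).
    rewrite mulr_sumr; apply: eq_bigr => k _; rewrite DE /kap.
    by field; rewrite !gt_eqF.
  apply: coneQ.2 => //; apply: cosk_increment => //.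
  - by apply: Hpos => //; exact: ltW.
  - by left.
  - move=> t C /andP[tT1 tT2] C0.
    under eq_bigr => k _ do
      rewrite opprD addrA sinB cospi sinpi mulr0 subr0 mulrN1 mulrN !mulNr mulrN opprK.
    by apply: HS' => //; rewrite /I ltNge TX /= ltW.
have /choice[t /choice[C tC]] := Ss.
have -> : \matrix_(i, k) s i k = \matrix_(i, k) ((C i * a) *
    (\matrix_(i, k) cosk (a - 1) (t i) (phi (lift ord0 k))) i k * sin (phi (lift ord0 k) - phi ord0)).
  by apply/matrixP => i k; have [_ _ e] := tC i; rewrite !mxE e.
rewrite det_scale_rows_cols big_split /= prodr_const card_ord.
set d := \det _; set p := \prod_i C i; set q := \prod_k sin _.
have -> : p * a ^+ N * q * d = p * q * (a ^+ N * d) by ring.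
apply: coneQ.2; first by rewrite mulr_gt0 ?prodr_gt0 // => i _; have [] := tC i.
have T_le i j : (i <= j)%N -> (j <= N.+1)%N -> T i <= T j.
  by rewrite leq_eqVlt => /predU1P[-> //|ij jN]; exact/ltW/T_inc.
(* The points [t i] increase because the intervals [I i] follow one another. If all entries are
   positive, every node lies before [X], so only the first kind of interval occurs. *)
apply: HQ => [i j ij|i|near i].
- have := ltn_ord j; have [_ + _] := tC i; have [_ + _] := tC j; rewrite /I => hj hi jN.
  have [iX|Xi] := ltP (T i.+1) X; move: hi hj.
    rewrite iX => /andP[_ ti]; case: ifP => _ /andP[tj _].
      by apply: lt_trans ti (le_lt_trans _ tj); apply: T_le => //; lia.
    by apply: lt_le_trans ti (le_trans _ tj); apply: T_le; lia.
  have Xj : X <= T j.+1 by apply: le_trans Xi _; apply: T_le; lia.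
  rewrite !(ltNge _ X) Xi Xj /=.
  by move=> /andP[_ ti] /andP[tj _]; apply: lt_le_trans ti (le_trans _ tj); apply: T_le; lia.
- have [_ + _] := tC i; rewrite /I.
  have /andP[r1 _] := T_rng i; have /andP[r2 _] := T_rng i.+1.
  have /andP[_ r3] := T_rng i.+1; have /andP[_ r4] := T_rng i.+2.
  case: ifP => _ /andP[h1 h2]; apply/andP; split.
  + exact: lt_trans h1.
  + exact: lt_le_trans r3.
  + exact: lt_le_trans h1.
  + exact: lt_le_trans r4.
- have [_ + _] := tC i; rewrite /I ifT => [/andP[h1 h2]|].
    rewrite -(TE ord0) -(TE ord_max); apply/andP; split.
      by apply: le_lt_trans h1; apply: T_le => //; have := ltn_ord i; lia.
    by apply: lt_le_trans h2 _; apply: T_le => //=; have := ltn_ord i; lia.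
  by have := near (lift ord0 i) ord0; rewrite -TE lift0 ltr_norml /X => /andP[_ ?]; lra.
Qed.
End Reduction.

(** * Sign and nonnegativity of the cosine determinants *)

(** Taking the predicted sign for [s] treats positive, negative and vanishing determinants at
    once. *)
Lemma sgr_convex_cone (R : realType) (s : R) : convex_cone (fun v : R => Num.sg v = s).
Proof.
split=> [u v <-|c u c0 <-]; last by rewrite sgrM gtr0_sg // mul1r.
case: (ltgtP u 0) => [u0|u0|->].
- rewrite (ltr0_sg u0) => sv; apply: ltr0_sg.
  by rewrite addrC ltr_wnDl // ltW // -sgr_lt0 sv ltrN10.
- rewrite (gtr0_sg u0) => sv; apply: gtr0_sg.
  by rewrite addrC ltr_wpDl // ltW // -sgr_gt0 sv.
- by rewrite sgr0 add0r.
Qed.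

(** One reduction contributes the factor of index 0; the factors for exponent [a - 1] are the
    remaining ones with the index shifted. *)
Lemma cosk_det_sign (R : realType) N (a : R) (theta phi : 'I_N.+1 -> R) :
  (forall i j : 'I_N.+1, (i < j)%N -> phi i < phi j) ->
  (forall i j : 'I_N.+1, (i < j)%N -> theta i < theta j) ->
  (forall i k, `|theta i - phi k| < pi / 2) ->
  Num.sg (\det (\matrix_(i, k) cosk a (theta i) (phi k))) =
    \prod_(i < N) Num.sg (a - i%:R) ^+ (N - i).
Proof.
elim: N a theta phi => [|N IH] a theta phi phi_inc theta_inc near.
  by rewrite det_mx11 mxE gtr0_sg ?big_ord0 // cosk_gt0.
have near' i k : - (pi / 2) < theta i - phi k < pi / 2 by rewrite -ltr_norml.
apply: (@cosk_det_reduction _ _ _ a theta phi (sgr_convex_cone _)) => //.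
- by have /andP[? ?] := near' ord0 ord0; have /andP[? ?] := near' ord0 ord_max; lra.
- move=> i; have /andP[? ?] := near' i ord0; have /andP[? ?] := near' i ord_max.
  by apply/andP; split; lra.
- by have /andP[? ?] := near' ord0 ord0; lra.
- by right.
move=> t t_inc _ /(_ near) tr; rewrite sgrM sgrX big_ord_recl subr0 subn0; congr (_ * _).
rewrite IH // => [|i j ij|i k].
- apply: eq_bigr => i _; rewrite lift0 subSS; congr (Num.sg _ ^+ _).
  by rewrite -natr1; ring.
- by apply: phi_inc; rewrite !lift0 ltnS.
- have /andP[? ?] := tr i; rewrite ltr_norml.
  have /andP[? ?] := near' ord0 (lift ord0 k); have /andP[? ?] := near' ord_max (lift ord0 k).
  by apply/andP; split; lra.
Qed.

(** Nodes violating the hypotheses of the reduction produce a zero row or a zero first column.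
    Otherwise the reduction applies as long as [0 < a], and lowers both sides of the bound on [a] by
    one. *)
Lemma cosk_det_ge0 (R : realType) N (a : R) (theta phi : 'I_N.+1 -> R) :
  N%:R - 1 <= a ->
  (forall i j : 'I_N.+1, (i < j)%N -> phi i < phi j) ->
  (forall i j : 'I_N.+1, (i < j)%N -> theta i < theta j) ->
  phi ord_max - phi ord0 < pi ->
  (forall i k, `|theta i - phi k| < 3 * (pi / 2)) ->
  0 <= \det (\matrix_(i, k) cosk a (theta i) (phi k)).
Proof.
elim: N a theta phi => [|N IH] a theta phi aN phi_inc theta_inc phi_pi rng.
  by rewrite det_mx11 mxE rpow0_ge0.
have rng' i k : - (3 * (pi / 2)) < theta i - phi k < 3 * (pi / 2) by rewrite -ltr_norml.
have phi_bnd := increasing_bounds phi_inc.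
have pi0 := pi_gt0 R.
have [i rowi|rows] := pickP (fun i => ~~ (phi ord0 - pi / 2 < theta i < phi ord_max + pi / 2)).
  rewrite (@det_row0 _ _ _ i) // => k; rewrite mxE; apply: cosk_eq0; rewrite rng andbT.
  have /andP[? ?] := phi_bnd k.
  by move: rowi; rewrite negb_and -!leNgt => /orP[?|?]; [rewrite ler0_norm|rewrite ger0_norm]; lra.
have [theta0|theta0] := ltP (theta ord0) (phi ord0 + pi / 2); last first.
  rewrite (@det_col0 _ _ _ ord0) // => i; rewrite mxE; apply: cosk_eq0; rewrite rng andbT.
  by have /andP[? _] := increasing_bounds theta_inc i; rewrite ger0_norm; lra.
have [a0|a0] := ltP 0 a.
  apply: (@cosk_det_reduction _ _ (fun v => 0 <= v) a theta phi) => //.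
  - by split=> [u v|c u c0] *; rewrite ?addr_ge0 // mulr_ge0 // ltW.
  - by move=> i; have /negbFE := rows i.
  - by left.
  move=> t t_inc tr _; apply: mulr_ge0; first by rewrite exprn_ge0 // ltW.
  apply: IH => //.
  - by move: aN; rewrite -natr1 => ?; lra.
  - by move=> i j ij; apply: phi_inc; rewrite !lift0 ltnS.
  - have /andP[? _] := phi_bnd (lift ord0 ord0).
    by have /andP[_ ?] := phi_bnd (lift ord0 ord_max); lra.
  - move=> i k; have /andP[? ?] := tr i; have /andP[? ?] := phi_bnd (lift ord0 k).
    by rewrite ltr_norml; apply/andP; split; lra.
(* Here only size 2 with exponent 0 is left. The entries indicate [|theta i - phi k| < pi / 2], and
   by the ordering of the nodes two ones off the diagonal force two ones on it. *)
have {}a0 : a = 0 by apply/eqP; rewrite eq_le a0 (le_trans _ aN) // subr_ge0 ler1n.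
have N0 : N = 0%N.
  by apply/eqP; rewrite -leqn0 -(ler_nat R); move: aN; rewrite a0 -natr1; lra.
move: theta phi phi_inc theta_inc phi_pi rng rng' phi_bnd rows theta0 {IH aN}.
rewrite N0 a0 => theta phi phi_inc theta_inc phi_pi rng _ _ _ _.
pose i1 : 'I_2 := lift ord0 ord0.
have ph : phi ord0 < phi i1 by exact: phi_inc.
have th : theta ord0 < theta i1 by exact: theta_inc.
rewrite (expand_det_row _ ord0) !big_ord_recl big_ord0 addr0 /cofactor !det_mx11 !mxE /=.
rewrite expr0 mul1r expr1 mulN1r mulrN subr_ge0.
have -> : lift (lift ord0 ord0) 0 = ord0 :> 'I_2 by exact: val_inj.
have -> : lift ord0 0 = i1 by exact: val_inj.
have E i k : cosk 0 (theta i) (phi k) = (`|theta i - phi k|%R < pi / 2)%R%:R.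
  by rewrite -cos_gt0E // /cosk /rpow0 powRr0; case: ifP.
rewrite !E -!natrM ler_nat !mulnb !ltr_norml.
case: andP => //= -[/andP[? ?] /andP[? ?]].
by rewrite lt0b; apply/andP; split; apply/andP; split; lra.
Qed.

(** * Transfer to the Jain-Karlin-Schoenberg kernel by arctangents *)

Lemma JKSpowE (R : realType) (a x y : R) : JKSpow a x y = rpow0 (1 + x * y) a.
Proof.
rewrite /JKSpow /JKS; case: (leP (1 + x * y) 0) => // h; by rewrite !rpow0_eq0.
Qed.

Lemma cos_atan_gt0 (R : realType) (x : R) : 0 < cos (atan x).
Proof. by apply: cos_gt0_pihalf; rewrite atan_gtNpi2 atan_ltpi2. Qed.

Lemma cos_atanB (R : realType) (x y : R) :
  cos (atan x - atan y) = cos (atan x) * cos (atan y) * (1 + x * y).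
Proof.
have cx := gt_eqF (cos_atan_gt0 x); have cy := gt_eqF (cos_atan_gt0 y).
rewrite -{3}(atanK x) -{3}(atanK y) /tan cosB.
by field; rewrite cx cy.
Qed.

Lemma dist_atan_lt (R : realType) (x y : R) : `|atan x - atan y| < 3 * (pi / 2).
Proof.
have := atan_gtNpi2 x; have := atan_ltpi2 x; have := atan_gtNpi2 y; have := atan_ltpi2 y.
have := pi_gt0 R => *; rewrite ltr_norml; apply/andP; split; lra.
Qed.

Lemma JKS_det_atan (R : realType) n (a : R) (x y : 'I_n -> R) :
  exists2 C : R, 0 < C & \det (\matrix_(j, k) cosk a (atan (x j)) (atan (y k))) =
     C * \det (\matrix_(j, k) JKSpow a (x j) (y k)).
Proof.
exists ((\prod_j rpow0 (cos (atan (x j))) a) * (\prod_k rpow0 (cos (atan (y k))) a)).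
  by apply: mulr_gt0; apply: prodr_gt0 => i _; apply/rpow0_gt0/cos_atan_gt0.
rewrite -det_scale_rows_cols; congr (\det _); apply/matrixP => j k; rewrite !mxE.
by rewrite /cosk cos_atanB -mulrA !rpow0M ?cos_atan_gt0 // JKSpowE mulrAC mulrA.
Qed.

Lemma JKS_det_sign (R : realType) N (a : R) (x y : 'I_N.+1 -> R) :
  inc setT x -> inc setT y -> (forall j k, 0 < 1 + x j * y k) ->
  Num.sg (\det (\matrix_(j, k) JKSpow a (x j) (y k))) = \prod_(i < N) Num.sg (a - i%:R) ^+ (N - i).
Proof.
move=> [_ xinc] [_ yinc] xy.
rewrite -(@cosk_det_sign _ _ a (fun j => atan (x j)) (fun k => atan (y k))).
- by have [C C0 ->] := JKS_det_atan a x y; rewrite sgrM (gtr0_sg C0) mul1r.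
- by move=> i j ij; apply/lt_atan/yinc.
- by move=> i j ij; apply/lt_atan/xinc.
- move=> j k; rewrite -cos_gt0E ?dist_atan_lt // cos_atanB.
  by rewrite !mulr_gt0 ?cos_atan_gt0.
Qed.

(** Arctangents lie in an open interval of length [pi], so the angle conditions of [cosk_det_ge0]
    hold for arbitrary real nodes. *)
Lemma JKS_det_ge0 (R : realType) N (a : R) (x y : 'I_N.+1 -> R) :
  N%:R - 1 <= a -> inc setT x -> inc setT y ->
  0 <= \det (\matrix_(j, k) JKSpow a (x j) (y k)).
Proof.
move=> aN [_ xinc] [_ yinc]; have [C C0 CE] := JKS_det_atan a x y.
rewrite -(pmulr_rge0 _ C0) -CE; apply: cosk_det_ge0 => //.
- by move=> i j ij; apply/lt_atan/yinc.
- by move=> i j ij; apply/lt_atan/xinc.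
- by have := atan_ltpi2 (y ord_max); have := atan_gtNpi2 (y ord0) => *; lra.
- by move=> i k; exact: dist_atan_lt.
Qed.

(** * Truncated powers and natural exponents on a half-line *)

(** Either the first column is zero, or two rows consist of ones, or the first column has a single
    one, at the top, and expansion along it reduces the size. *)
Lemma heaviside_det_ge0 (R : realType) n (y s : 'I_n -> R) :
  (forall i j : 'I_n, (i < j)%N -> y i < y j) ->
  (forall i j : 'I_n, (i < j)%N -> s i < s j) ->
  0 <= \det (\matrix_(j, k) rpow0 (y k - s j) 0).
Proof.
elim: n y s => [|n IH] y s yinc sinc; first by rewrite det_mx00.
have E u : rpow0 u 0 = (0 < u)%R%:R :> R by rewrite /rpow0 powRr0; case: ifP.
have y0le k : y ord0 <= y k by have /andP[] := increasing_bounds yinc k.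
have s0le k : s ord0 <= s k by have /andP[] := increasing_bounds sinc k.
have [y0s0|s0y0] := leP (y ord0) (s ord0).
  rewrite (@det_col0 _ _ _ ord0) // => j; rewrite mxE rpow0_eq0 // subr_le0.
  exact: le_trans (s0le j).
case: (boolP [exists j : 'I_n, s (lift ord0 j) < y ord0]) => [/existsP[j sj]|/existsPn H].
  rewrite (@determinant_alternate _ _ _ ord0 (lift ord0 j)) // => k.
  by rewrite !mxE !E !subr_gt0 !(lt_le_trans _ (y0le k)).
rewrite det_col_delta => [|j]; last by rewrite mxE rpow0_eq0 // subr_le0 leNgt.
rewrite mulr_ge0 ?mxE ?rpow0_ge0 //.
have := IH (fun k => y (lift ord0 k)) (fun j => s (lift ord0 j)).
set A := \matrix_(j, k) _; set B := \matrix_(j, k) _.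
have -> : B = A by apply/matrixP => j k; rewrite !mxE.
by apply=> i j ij; [apply: yinc|apply: sinc]; rewrite !lift0 ltnS.
Qed.

(** Subtracting from each row its predecessor gives increments in the node; differentiating them
    lowers the exponent to [m] at intermediate nodes. *)
Lemma truncated_power_det_ge0 (R : realType) m n (y s : 'I_n -> R) :
  (forall i j : 'I_n, (i < j)%N -> y i < y j) ->
  (forall i j : 'I_n, (i < j)%N -> s i < s j) ->
  0 <= \det (\matrix_(i, k) rpow0 (y i - s k) m%:R).
Proof.
elim: m n y s => [|m IH] [|n] y s yinc sinc; rewrite ?det_mx00 //.
  rewrite -det_tr; have := heaviside_det_ge0 yinc sinc.
  by congr (0 <= \det _); apply/matrixP => i k; rewrite !mxE.
(* The extra node lies to the left of all [s k], where the truncated powers vanish. *)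
pose u (i : 'I_n.+1) : R := if i == ord0 then Num.min (y ord0) (s ord0) - 1 else y (inord i.-1).
have pK (i : 'I_n.+1) : (inord i.-1 : 'I_n.+1) = i.-1 :> nat.
  by rewrite inordK // (leq_ltn_trans (leq_pred _)).
have uy i : u i < y i.
  rewrite /u; case: eqP => [->|/eqP i0]; first by have := ge_min (y ord0) (y ord0) (s ord0); rewrite lexx => /esym ?; lra.
  have i0' : (0 < i)%N by rewrite lt0n.
  by apply: yinc; rewrite pK prednK.
(* The intervals from [u i] to [y i] do not overlap, so the intermediate nodes are again
   increasing. *)
have yu (i j : 'I_n.+1) : (i < j)%N -> y i <= u j.
  move=> ij; rewrite /u ifF; last by apply/eqP => j0; rewrite j0 in ij.
  have [ij'|ij'] := ltnP i (inord j.-1 : 'I_n.+1); first exact/ltW/yinc.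
  rewrite (_ : i = inord j.-1) //; apply: val_inj => /=; move: ij'; rewrite pK; lia.
pose C := \matrix_(i < n.+1, j < n.+1) (if i == j.+1 :> nat then -1 else 0 : R).
set A := \matrix_(i, k) _.
rewrite -(@det_row_op_lower _ _ C); last first.
  by move=> i j ij; rewrite mxE; case: eqP => // e; move: ij; rewrite e ltnn.
have -> : A + C *m A =
    \matrix_(i, k) (rpow0 (y i - s k) m.+1%:R - rpow0 (u i - s k) m.+1%:R).
  apply/matrixP => i k; rewrite !mxE; congr (_ + _); rewrite /u.
  have [->|i0] := eqVneq i ord0.
    rewrite rpow0_eq0 ?oppr0.
      by rewrite big1 // => j _; rewrite mxE mul0r.
    have /andP[+ _] := increasing_bounds sinc k.
    have := ge_min (s ord0) (y ord0) (s ord0); rewrite lexx orbT => /esym ? ?; lra.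
  have i0' : (0 < i)%N by rewrite lt0n.
  rewrite (bigD1 (inord i.-1)) //= big1 ?addr0 => [|j jne].
    by rewrite !mxE pK prednK // eqxx mulN1r.
  rewrite mxE; case: eqP => [e|]; last by rewrite mul0r.
  by case/eqP: jne; apply: val_inj; rewrite e /= inord_val.
pose S (i : 'I_n.+1) (v : 'I_n.+1 -> R) := exists2 t : R, u i < t < y i &
  v = fun k => m.+1%:R * rpow0 (t - s k) m%:R.
apply: (@det_rows_in_cone _ _ (fun v => 0 <= v) S
  (fun i k => rpow0 (y i - s k) m.+1%:R - rpow0 (u i - s k) m.+1%:R)) => [i c HS|v Sv].
  pose G := \sum_(k < n.+1) (c k \*: (fun t => rpow0 (t - s k) m.+1%:R)).
  have GE t : G t = \sum_k c k * rpow0 (t - s k) m.+1%:R by rewrite /G fct_sumE.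
  have -> : \sum_k c k * (rpow0 (y i - s k) m.+1%:R - rpow0 (u i - s k) m.+1%:R) = G (y i) - G (u i).
    by rewrite !GE -sumrB; apply: eq_bigr => k _; rewrite mulrBr.
  apply: (@increment_in_cone _ (fun v => 0 <= v) [seq s k | k <- enum 'I_n.+1] G
    (fun t => \sum_k c k * (m.+1%:R * rpow0 (t - s k) m%:R))) => //.
  - by split=> [? ?|? ? ?] *; rewrite ?addr_ge0 // mulr_ge0 // ltW.
  - move=> t _; apply: lincomb_continuous => k.
    apply: (@continuous_comp _ _ _ (fun t => t - s k) (fun x => rpow0 x m.+1%:R)).
      apply: differentiable_continuous; apply/derivable1_diffP.
      exact: (@ex_derive _ _ _ _ _ _ _ (is_derive_shift t 1 (- s k))).
    by apply: rpow0_continuous; left; rewrite ltr0n.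
  - move=> t _ tS.
    have -> : \sum_k c k * (m.+1%:R * rpow0 (t - s k) m%:R) =
        \sum_(k < n.+1) (c k *: ((m.+1%:R * rpow0 (t - s k) (m.+1%:R - 1)) * 1)).
      by apply: eq_bigr => k _; rewrite mulr1 -natr1 addrK.
    apply: is_derive_sum => k; apply: is_deriveZ.
    apply: (@is_derive1_comp _ (fun x => rpow0 x m.+1%:R) (shift (- s k))).
      apply: is_derive_rpow0; rewrite subr_eq0; apply: contraNneq tS => ->.
      by rewrite map_f ?mem_enum.
    exact: is_derive_shift.
  - by move=> t ti _; apply: HS; exists t.
have /choice[t tP] : forall i, exists t : R, u i < t < y i /\ v i = fun k => m.+1%:R * rpow0 (t - s k) m%:R.
  by move=> i; have [t ? ?] := Sv i; exists t.
have -> : \matrix_(i, k) v i k = \matrix_(i < n.+1, k < n.+1)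
    (m.+1%:R * (\matrix_(i, k) rpow0 (t i - s k) m%:R) i k * 1).
  by apply/matrixP => i k; rewrite !mxE mulr1 (tP i).2.
rewrite (det_scale_rows_cols (fun=> m.+1%:R) (fun=> 1)) mulr_ge0 //.
  by rewrite mulr_ge0 // prodr_ge0.
apply: IH => // i j ij; have [/andP[_ ti] _] := tP i; have [/andP[tj _] _] := tP j.
exact: lt_trans ti (le_lt_trans (yu i j ij) tj).
Qed.

(** Factoring [x] out of [1 + x * y] leaves a truncated power with knot [- x^-1], and these knots
    increase with [x > 0]. *)
Lemma JKS_nat_det_pos_nodes (R : realType) m n (x y : 'I_n -> R) :
  (forall i j : 'I_n, (i < j)%N -> x i < x j) ->
  (forall i j : 'I_n, (i < j)%N -> y i < y j) -> (forall i, 0 < x i) ->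
  0 <= \det (\matrix_(j, k) JKSpow m%:R (x j) (y k)).
Proof.
move=> xinc yinc x0.
have -> : \matrix_(j, k) JKSpow m%:R (x j) (y k) = \matrix_(j, k)
    (rpow0 (x j) m%:R * (\matrix_(i, k) rpow0 (y i - - (x k)^-1) m%:R)^T j k * 1).
  apply/matrixP => j k; rewrite !mxE mulr1 -rpow0M // JKSpowE; congr rpow0.
  by field; rewrite gt_eqF.
rewrite (det_scale_rows_cols (fun j => rpow0 (x j) m%:R) (fun=> 1)) det_tr mulr_ge0 //.
  by rewrite mulr_ge0 // prodr_ge0 // => i _; exact: rpow0_ge0.
apply: (@truncated_power_det_ge0 _ m n y (fun j => - (x j)^-1)) => // i j ij.
by rewrite ltrN2 ltf_pV2 ?posrE // xinc.
Qed.

(* The rotation x |-> (x + e) / (1 - e x), applied to both arguments, changes 1 + x y only by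
   positive factors; for small e it makes all nodes x >= 0 strictly positive. *)
Lemma JKS_nat_det_ge0 (R : realType) m n (x y : 'I_n -> R) :
  (forall i j : 'I_n, (i < j)%N -> x i < x j) ->
  (forall i j : 'I_n, (i < j)%N -> y i < y j) -> (forall i, 0 <= x i) ->
  0 <= \det (\matrix_(j, k) JKSpow m%:R (x j) (y k)).
Proof.
move=> xinc yinc x0.
(* [M] exceeds every node, so with [e = M^-1] all denominators [1 - e * z] are positive and the
   rotation preserves the order of the nodes. *)
pose M : R := 1 + (\sum_i `|x i| + \sum_i `|y i|).
have le_sum (z : 'I_n -> R) i : z i <= \sum_j `|z j|.
  by rewrite (bigD1 i) //= (le_trans (ler_norm _)) // lerDl sumr_ge0.
have sum_ge0 (z : 'I_n -> R) : 0 <= \sum_j `|z j| by exact: sumr_ge0.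
have Mx z : (exists i, z = x i) \/ (exists i, z = y i) -> z < M.
  have := sum_ge0 x; have := sum_ge0 y; rewrite /M.
  by move=> ? ? [] [i ->]; [have := le_sum x i|have := le_sum y i] => ?; lra.
have M0 : 0 < M by have := sum_ge0 x; have := sum_ge0 y; rewrite /M => *; lra.
have e2 (c : R) : 0 < 1 + c ^+ 2 by rewrite ltr_wpDr ?sqr_ge0.
pose e := M^-1; have e0 : 0 < e by rewrite invr_gt0.
have eM z : z < M -> 0 < 1 - e * z by move=> zM; rewrite subr_gt0 mulrC ltr_pdivrMr // mul1r.
have ex i : 0 < 1 - e * x i by apply/eM/Mx; left; exists i.
have ey i : 0 < 1 - e * y i by apply/eM/Mx; right; exists i.
pose r z := (z + e) / (1 - e * z).
have r_lt z z' : 0 < 1 - e * z -> 0 < 1 - e * z' -> z < z' -> r z < r z'.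
  move=> h h' zz'; rewrite /r ltr_pdivrMr // mulrAC ltr_pdivlMr // -subr_gt0.
  have -> : (z' + e) * (1 - e * z) - (z + e) * (1 - e * z') = (z' - z) * (1 + e ^+ 2) by ring.
  by rewrite mulr_gt0 ?subr_gt0 // ltr_wpDr ?sqr_ge0.
pose A := \matrix_(j, k) JKSpow m%:R (r (x j)) (r (y k)).
have : 0 <= \det A.
  apply: JKS_nat_det_pos_nodes => [i j ij|i j ij|i].
  - by apply: r_lt => //; exact: xinc.
  - by apply: r_lt => //; exact: yinc.
  - by rewrite divr_gt0 // ltr_wpDl.
(* This rests on [1 + r x * r y = (1 + e ^+ 2) * (1 + x * y) / ((1 - e * x) * (1 - e * y))]. *)
have -> : \det A = (\prod_j rpow0 ((1 + e ^+ 2) / (1 - e * x j)) m%:R) *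
    (\prod_k rpow0 (1 - e * y k)^-1 m%:R) * \det (\matrix_(j, k) JKSpow m%:R (x j) (y k)).
  rewrite -det_scale_rows_cols; congr (\det _); apply/matrixP => j k; rewrite !mxE !JKSpowE.
  rewrite -rpow0M ?divr_gt0 // [RHS]mulrC -rpow0M ?invr_gt0 //.
  by congr rpow0; rewrite /r; field; rewrite !gt_eqF.
rewrite pmulr_rge0 //.
by apply: mulr_gt0; apply: prodr_gt0 => i _; apply: rpow0_gt0; rewrite ?invr_gt0 // divr_gt0.
Qed.

(** * Minors of definite sign, and the theorem *)

Lemma inc_comp (R : realType) (X : set R) r m (x : 'I_m -> R) (f : 'I_r -> 'I_m) :
  inc X x -> incidx f -> inc X (x \o f).
Proof. by move=> [xX xinc] finc; split=> [i|i j ij]; [exact: xX|exact/xinc/finc]. Qed.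

Lemma incidx_leq r m (f : 'I_r -> 'I_m) : incidx f -> (r <= m)%N.
Proof.
move=> finc; rewrite -(card_ord r) -(card_ord m); apply: (leq_card f) => i j fij.
by apply: val_inj => /=; case: (ltngtP i j) => // /finc; rewrite fij ltnn.
Qed.

Lemma sub_TNp (R : realType) (X X' Y Y' : set R) (K : R -> R -> R) p :
  X `<=` X' -> Y `<=` Y' -> TNp X' Y' K p -> TNp X Y K p.
Proof.
move=> XX' YY' TN r rp x y [xX xinc] [yY yinc]; apply: TN => //.
  by split=> // i; exact/XX'/xX.
by split=> // i; exact/YY'/yY.
Qed.

Lemma TNp_swap (R : realType) (X Y : set R) (K : R -> R -> R) p :
  (forall x y, K x y = K y x) -> TNp X Y K p -> TNp Y X K p.
Proof.
move=> KC TN r rp x y xY yX; rewrite -det_tr.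
have -> : (\matrix_(j, k) K (x j) (y k))^T = \matrix_(j, k) K (y j) (x k).
  by apply/matrixP => j k; rewrite !mxE KC.
exact: TN.
Qed.

Lemma JKSpowC (R : realType) (a x y : R) : JKSpow a x y = JKSpow a y x.
Proof. by rewrite !JKSpowE mulrC. Qed.

Lemma JKS_det_gt0 (R : realType) N (a : R) (x y : 'I_N.+1 -> R) :
  N%:R - 1 < a -> inc setT x -> inc setT y -> (forall j k, 0 < 1 + x j * y k) ->
  0 < \det (\matrix_(j, k) JKSpow a (x j) (y k)).
Proof.
move=> aN xinc yinc xy; rewrite -sgr_gt0 JKS_det_sign // prodr_gt0 // => i _.
rewrite exprn_gt0 // sgr_gt0 subr_gt0 (le_lt_trans _ aN) //.
by rewrite lerBrDr natr1 ler_nat.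
Qed.

(** The factor of index [n] in the sign product is zero, its exponent [N - n] being positive. *)
Lemma JKS_nat_det_eq0 (R : realType) N n (x y : 'I_N.+1 -> R) :
  (n < N)%N -> inc setT x -> inc setT y -> (forall j k, 0 < 1 + x j * y k) ->
  \det (\matrix_(j, k) JKSpow n%:R (x j) (y k)) = 0.
Proof.
move=> nN xinc yinc xy; apply/eqP; rewrite -sgr_eq0 JKS_det_sign //.
by rewrite (bigD1 (Ordinal nN)) //= subrr sgr0 expr0n subn_eq0 leqNgt nN mul0r.
Qed.

(** In size [m + 3] the only negative factor has index [m + 1], and its exponent is 1. *)
Lemma JKS_det_lt0 (R : realType) m (a : R) (x y : 'I_m.+3 -> R) :
  m%:R < a < m.+1%:R -> inc setT x -> inc setT y -> (forall j k, 0 < 1 + x j * y k) ->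
  \det (\matrix_(j, k) JKSpow a (x j) (y k)) < 0.
Proof.
move=> /andP[ma am] xinc yinc xy; rewrite -sgr_lt0 JKS_det_sign // big_ord_recr /=.
rewrite subSnn expr1 (ltr0_sg (x := a - _)) ?subr_lt0 // mulrN1 oppr_lt0 prodr_gt0 // => i _.
by rewrite exprn_gt0 // sgr_gt0 subr_gt0 (le_lt_trans _ ma) // ler_nat -ltnS.
Qed.

Lemma not_natR_itv (R : realType) (a : R) : 0 <= a -> ~ is_natR a ->
  exists m : nat, m%:R < a < m.+1%:R.
Proof.
move=> a0 aN; exists (Num.truncn a); have /andP[h1 ->] := truncn_itv a0.
rewrite andbT lt_neqAle h1 andbT; apply/eqP => e; apply: aN.
by exists (Num.truncn a).
Qed.

(** A non-integral [a < p - 2] lies between some [m] and [m + 1] with [m + 3 <= p], so a negative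
    determinant of size [m + 3] is available. The nodes are a hypothesis, to cover both the plane
    and the half-lines. *)
Lemma TNp_JKSpow_exponent (R : realType) (X Y : set R) (a : R) p : 0 <= a ->
  (forall r, exists x y : 'I_r -> R, [/\ inc X x, inc Y y & forall j k, 0 < 1 + x j * y k]) ->
  TNp X Y (JKSpow a) p -> is_natR a \/ p%:R - 2 <= a.
Proof.
move=> a0 nodes TN; have [|aN] := pselect (is_natR a); [by left|right].
rewrite leNgt; apply/negP => ap; have [m mam] := not_natR_itv a0 aN.
have mp : (m.+3 <= p)%N.
  rewrite -(ltr_nat R) -natr1 -natr1; have /andP[ma _] := mam.
  by lra.
have [x [y [xX yY xy]]] := nodes m.+3.
have := TN m.+3 mp x y xX yY; rewrite leNgt => /negP; apply; apply: JKS_det_lt0 => //.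
- by have [_ ?] := xX.
- by have [_ ?] := yY.
Qed.

(** The [x j] are equally spaced from [u] on; the [y k] are integers chosen with the sign of [I], so
    that all products are nonnegative. *)
Lemma half_line_nodes (R : realType) (I : set R) r : is_interval I ->
  (exists u v, I u /\ I v /\ u < v) ->
  (I `<=` [set t | 0 <= t] \/ I `<=` [set t | t <= 0]) ->
  exists x y : 'I_r -> R, [/\ inc I x, inc setT y & forall j k, 0 < 1 + x j * y k].
Proof.
move=> Iitv [u [v [Iu [Iv uv]]]] Isgn.
pose x (j : 'I_r) : R := u + (v - u) * (j%:R / r%:R).
have r0 (j : 'I_r) : 0 < r%:R :> R by rewrite ltr0n (leq_ltn_trans _ (ltn_ord j)).
have xinc : inc I x.
  split=> [j|i j ij].
    have j1 : 0 <= (j%:R / r%:R : R) <= 1.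
      by rewrite divr_ge0 //= ler_pdivrMr ?(r0 j) // mul1r ler_nat ltnW.
    apply: (Iitv u v) => //; rewrite /x; have vu : 0 < v - u by rewrite subr_gt0.
    case/andP: j1 => j0 j1; rewrite lerDl mulr_ge0 ?(ltW vu) //=.
    by rewrite -lerBrDl ler_piMr // ltW.
  by rewrite /x ltrD2l ltr_pM2l ?subr_gt0 // ltr_pM2r ?invr_gt0 ?(r0 i) // ltr_nat.
have [xI _] := xinc.
case: Isgn => Isgn.
  exists x, (fun k => k%:R); split=> // [|j k]; first by split=> // i j ij; rewrite ltr_nat.
  by rewrite ltr_wpDr // mulr_ge0 //; exact/Isgn/xI.
exists x, (fun k => k%:R - r%:R); split=> // [|j k].
  by split=> // i j ij; rewrite ltrD2r ltr_nat.
rewrite ltr_wpDr // mulr_le0 //; first exact/Isgn/xI.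
by rewrite subr_le0 ler_nat ltnW.
Qed.

Lemma JKSpow_TNp (R : realType) (a : R) p : p%:R - 2 <= a -> TNp setT setT (JKSpow a) p.
Proof.
move=> ap [|r] // /andP[_ rp] x y xinc yinc; apply: JKS_det_ge0 => //.
by apply: le_trans ap; move: rp; rewrite -(ler_nat R) -natr1 => ?; lra.
Qed.

Lemma JKSpow_nat_TNker (R : realType) (I : set R) n :
  (I `<=` [set t | 0 <= t] \/ I `<=` [set t | t <= 0]) -> TNker I setT (JKSpow (n%:R : R)).
Proof.
move=> Isgn p r _ x y [xI xinc] [_ yinc]; case: Isgn => Isgn.
  by apply: JKS_nat_det_ge0 => // i; exact/Isgn/xI.
(* Negating both arguments preserves [1 + x * y] but reverses both orders; reversing rows and
   columns repairs this. *)
rewrite -det_rev.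
have -> : \matrix_(j, k) (\matrix_(j, k) JKSpow n%:R (x j) (y k)) (rev_ord j) (rev_ord k) =
    \matrix_(j, k) JKSpow n%:R (- x (rev_ord j)) (- y (rev_ord k)).
  by apply/matrixP => j k; rewrite !mxE !JKSpowE mulrNN.
apply: JKS_nat_det_ge0 => [i j ij|i j ij|i].
- by rewrite ltrN2; apply: xinc => /=; have := ltn_ord j; lia.
- by rewrite ltrN2; apply: yinc => /=; have := ltn_ord j; lia.
- by rewrite oppr_ge0; exact/Isgn/xI.
Qed.

Theorem theoremC (R : realType) (p : nat) (a : R) (hp : (2 <= p)%N) (ha : 0 <= a) :
  (* (1) *)
  ((p%:R - 2 <= a) -> TNp setT setT (JKSpow a) p)
  /\
  (* (2) *)
  ((TNp setT setT (JKSpow a) p -> is_natR a \/ p%:R - 2 <= a)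
   /\ (forall x y : 'I_p -> R, inc setT x -> inc setT y ->
         (forall j k, 0 < 1 + x j * y k) ->
         let M := \matrix_(j < p, k < p) JKSpow a (x j) (y k) in
         (p%:R - 2 < a -> TPmx M)
         /\ ((exists n : nat, (n <= p - 2)%N /\ a = n%:R) -> TNmx M)
         /\ (0 < a -> a < p%:R - 2 -> ~ is_natR a -> ~ TNmx M)))
  /\
  (* (3) *)
  (forall I : set R, is_interval I ->
     (exists u v, I u /\ I v /\ u < v) ->
     (I `<=` [set t | 0 <= t] \/ I `<=` [set t | t <= 0]) ->
     (TNp I setT (JKSpow a) p <-> is_natR a \/ p%:R - 2 <= a)
     /\ (TNp setT I (JKSpow a) p <-> is_natR a \/ p%:R - 2 <= a)
     /\ (is_natR a -> TNker I setT (JKSpow a) /\ TNker setT I (JKSpow a))).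
Proof.
split; first exact: JKSpow_TNp.
split; [split|].
- apply: TNp_JKSpow_exponent => // r; exists (fun i => i%:R), (fun i => i%:R).
  split=> [||j k]; [| |by rewrite ltr_wpDr // mulr_ge0];
    by split=> // i j ij; rewrite ltr_nat.
- move=> x y xinc yinc xy M.
  have minorE r (f g : 'I_r -> 'I_p) : minor M f g =
      \det (\matrix_(j, k) JKSpow a ((x \o f) j) ((y \o g) k)).
    by congr (\det _); apply/matrixP => j k; rewrite !mxE.
  split=> [pa|]; [|split].
  + move=> [|r] f g // _ finc ginc; rewrite minorE; apply: JKS_det_gt0 => //.
    * by apply: le_lt_trans pa; have := incidx_leq finc; rewrite -(ler_nat R) -natr1 => ?; lra.
    * exact: inc_comp.
    * exact: inc_comp.
    * by move=> j k; exact: xy.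
  + move=> [n [_ an]] [|r] f g // _ finc ginc; rewrite minorE.
    have xf := inc_comp xinc finc; have yg := inc_comp yinc ginc.
    (* The minor has size [r + 1]: it vanishes for [n < r], and for [r <= n] the exponent is large
       enough for nonnegativity. *)
    have [nr|rn] := ltnP n r; first by rewrite an JKS_nat_det_eq0 // => j k; exact: xy.
    by apply: JKS_det_ge0 => //; move: rn; rewrite an -(ler_nat R) => ?; lra.
  + move=> a0 ap aN TN; have [m mam] := not_natR_itv ha aN.
    have mp : (m.+3 <= p)%N.
      by rewrite -(ltr_nat R) -natr1 -natr1; have /andP[ma _] := mam; lra.
    (* The leading principal minor of size [m + 3] is the negative one. *)
    have winc : incidx (widen_ord mp) by [].
    have := TN m.+3 _ _ isT winc winc; rewrite leNgt minorE => /negP; apply.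
    by apply: JKS_det_lt0 => [//|||j k]; [exact: inc_comp|exact: inc_comp|exact: xy].
- move=> I Iitv Iuv Isgn.
  have TNnat : is_natR a -> TNker I setT (JKSpow a) by move=> [n ->]; exact: JKSpow_nat_TNker.
  have TNI : TNp I setT (JKSpow a) p <-> is_natR a \/ p%:R - 2 <= a.
    split; first by apply: TNp_JKSpow_exponent => // r; exact: half_line_nodes.
    case=> [an|/JKSpow_TNp]; first exact: TNnat.
    exact: sub_TNp.
  have swap X Y q : TNp X Y (JKSpow a) q -> TNp Y X (JKSpow a) q.
    by apply: TNp_swap => x y; exact: JKSpowC.
  split=> //; split; last by move=> an; split=> [|q]; [exact: TNnat|exact/swap/TNnat].
  by split=> [/swap/TNI.1|/TNI.2/swap].
Qed.
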